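(* Let $D$ be a digraph of order $p\geq 5$ such that $d(x)=id(x)+od(x)\geq p-1$ for every vertex $x$, and $\min\{id(x),od(x)\}\geq p/2-1$ for every vertex $x$. Put $n:=\lfloor p/2\rfloor$. Then: (i) either $D$ contains a directed cycle of length $3$, or $D\in \mathcal{B}(n,n)\cup\{Q_5^*,\,K_{n,n+1}^*\}$; (ii) either $D$ contains a directed cycle of length $4$, or $D\in \mathcal{H}(3,3)\cup\{Q_5^*,\,H'_6,\,H''_6,\,H'''_6,\,[(K_2\cup K_2)+K_1]^*\}$. (Membership is up to isomorphism.)
   Context: Digraphs are finite, without loops and without multiple arcs, but may contain both arcs $xy$ and $yx$ (a cycle of length 2). For a vertex $x$, $O(x)$ and $I(x)$ are its out- and in-neighbourhoods, $od(x)=|O(x)|$, $id(x)=|I(x)|$, $d(x)=od(x)+id(x)$. Cycles are directed and simple. For an undirected graph $G$, $G^*$ denotes the symmetric digraph obtained by replacing each edge $xy$ by the two arcs $xy,yx$. $K_m$ is the complete graph, $K_{a,b}$ the complete bipartite graph, $Q_k$ the undirected cycle of length $k$; $G_1\cup G_2$ is disjoint union and $G_1+G_2$ is the join. $K_m^*$ is thus the complete symmetric digraph on $m$ vertices. $\mathcal{B}(n,n)$: the set of digraphs of order $2n\geq 6$ obtained from $K^*_{n,n}$ by deleting $k$ pairwise vertex-disjoint arcs, where $0\leq k\leq n$. $\mathcal{H}(n,n)$ (for $n\geq1$): the set of digraphs $D$ of order $2n$ with $V(D)=F\cup B$, $|F|=|B|=n$, $D[F]$ and $D[B]$ both complete symmetric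 digraphs $K_n^*$, no arc from a vertex of $B$ to a vertex of $F$, every vertex of $F$ has an out-neighbour in $B$ and every vertex of $B$ has an in-neighbour in $F$. $H'_6$: with $Q_6$ the undirected cycle $xvwuyzx$, the digraph obtained from $Q_6^*$ by adding the arcs $xy, xw, zu, vu$. $H''_6$: the digraph obtained from the directed cycle $xyvzwux$ by adding the arcs $xv, vx, xu, xw, uz, yu, yz, zy, wz, wv$. $H'''_6$: the digraph obtained from the directed cycle $xwvzyux$ by adding the arcs $xy, yv, vx, uz, zw, wu, xu, yz, vw$. *)

(* Defs.v *)
From mathcomp Require Import all_boot.

Set Implicit Arguments.
Unset Strict Implicit.
Unset Printing Implicit Defensive.

(* A digraph without loops and multiple arcs is an irreflexive [D : rel T] on a
   [T : finType].  An undirected graph is a symmetric irreflexive relation: the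
   symmetric digraph G^* has the very same relation as G, so the definitions
   below of K_m, K_{a,b}, Q_k, G1 :|: G2, G1 + G2 also denote K_m^*, etc. *)

Section Digraph.
Variables (T : finType) (D : rel T).

Definition outdeg (x : T) : nat := #|[set y | D x y]|.
Definition indeg (x : T) : nat := #|[set y | D y x]|.
Definition deg (x : T) : nat := indeg x + outdeg x.

Definition has_cycle (k : nat) : Prop :=
  exists c : seq T, [/\ size c = k, cycle D c & uniq c].

End Digraph.

Definition isomorphic (S T : finType) (D : rel S) (E : rel T) : Prop :=
  exists2 f : S -> T, bijective f & {mono f : x y / D x y >-> E x y}.

Definition complete (m : nat) : rel 'I_m := fun i j => i != j.

Definition complete_bipartite (a b : nat) : rel ('I_a + 'I_b)%type :=
  fun s t => match s, t with
             | inl _, inr _ | inr _, inl _ => true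
             | _, _ => false
             end.

(* Only meaningful for k >= 3. *)
Definition cycle_graph (k : nat) : rel 'I_k :=
  fun i j => (j == ordS i) || (i == ordS j).

Definition disjoint_union (S T : finType) (G : rel S) (H : rel T) :
    rel (S + T)%type :=
  fun s t => match s, t with
             | inl x, inl y => G x y
             | inr x, inr y => H x y
             | _, _ => false
             end.

Definition join (S T : finType) (G : rel S) (H : rel T) : rel (S + T)%type :=
  fun s t => match s, t with
             | inl x, inl y => G x y
             | inr x, inr y => H x y
             | _, _ => true
             end.

(* Two arcs are vertex-disjoint when their four ends are distinct; [A] is the
   set of deleted arcs. *)
Definition in_B (n : nat) (T : finType) (D : rel T) : Prop :=
  6 <= 2 * n /\
  exists A : {set ('I_n + 'I_n) * ('I_n + 'I_n)},
    [/\ forall a, a \in A -> complete_bipartite a.1 a.2,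
        #|A| <= n,
        forall a b, a \in A -> b \in A -> a != b ->
          [disjoint [:: a.1; a.2] & [:: b.1; b.2]]
      & isomorphic D
          (fun s t => @complete_bipartite n n s t && ((s, t) \notin A))].

Definition in_H (n : nat) (T : finType) (D : rel T) : Prop :=
  1 <= n /\ #|T| = 2 * n /\
  exists F B : {set T},
    [/\ F :|: B = [set: T], #|F| = n & #|B| = n] /\
    [/\ forall x y, x \in F -> y \in F -> D x y = (x != y),
        forall x y, x \in B -> y \in B -> D x y = (x != y),
        forall x y, x \in B -> y \in F -> ~~ D x y,
        forall x, x \in F -> exists2 y, y \in B & D x y
      & forall y, y \in B -> exists2 x, x \in F & D x y].

Definition of_arcs (n : nat) (s : seq (nat * nat)) : rel 'I_n :=
  fun i j => (nat_of_ord i, nat_of_ord j) \in s.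

(* The arcs of the directed cycle [c]. *)
Definition cycle_arcs (c : seq nat) : seq (nat * nat) := zip c (rot 1 c).

Definition reverse_arcs (s : seq (nat * nat)) : seq (nat * nat) :=
  [seq (a.2, a.1) | a <- s].

Section SixVertices.
Let x := 0.
Let y := 1.
Let z := 2.
Let u := 3.
Let v := 4.
Let w := 5.

Definition H6' : rel 'I_6 :=
  of_arcs (cycle_arcs [:: x; v; w; u; y; z] ++
           reverse_arcs (cycle_arcs [:: x; v; w; u; y; z]) ++
           [:: (x, y); (x, w); (z, u); (v, u)]).

Definition H6'' : rel 'I_6 :=
  of_arcs (cycle_arcs [:: x; y; v; z; w; u] ++
           [:: (x, v); (v, x); (x, u); (x, w); (u, z);
               (y, u); (y, z); (z, y); (w, z); (w, v)]).

Definition H6''' : rel 'I_6 :=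
  of_arcs (cycle_arcs [:: x; w; v; z; y; u] ++
           [:: (x, y); (y, v); (v, x); (u, z); (z, w);
               (w, u); (x, u); (y, z); (v, w)]).

End SixVertices.

(* Main.v *)
Require Import Defs.
From mathcomp Require Import all_boot all_algebra.
From mathcomp Require Import zify.

Set Implicit Arguments.
Unset Strict Implicit.
Unset Printing Implicit Defensive.

(* (i) If D has no 3-cycle, then O(y) and I(x) are disjoint for every arc xy,
   and both also miss x and y when yx is not an arc.  For p = 2n + 1 this
   forces D to be symmetric, hence a triangle-free graph of minimum degree n.
   For p = 2n the arcs without a reverse form a matching, so that the underlying
   graph is triangle-free of minimum degree n, hence K_{n,n}.

   (ii) If D has no 4-cycle, then for every arc xy no arc goes from
   A = O(y) \ x to B = I(x) \ y.  Hence a vertex a of A \ B satisfies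
   O(a) <= V \ ({x, a} u B), where the degree conditions leave almost no slack;
   two vertices z, z' of A n B are joined by many paths z -> w -> z' and
   z' -> w' -> z, which bounds |A n B| by 2.  For p >= 7 this yields first that D
   is symmetric and then a contradiction.  The orders 5 and 6 are settled by an
   exhaustive search, run by reduction on boolean matrices. *)

(** * Digraphs without 4-cycles on five and six vertices *)

(* [seq.has] and [seq.all] evaluate all their items under call by value. *)
Fixpoint lazy_has (A : Type) (a : A -> bool) (s : seq A) : bool :=
  if s is x :: s' then if a x then true else lazy_has a s' else false.

Definition lazy_all (A : Type) (a : A -> bool) (s : seq A) : bool :=
  ~~ lazy_has (fun x => ~~ a x) s.

Lemma lazy_hasE (A : Type) (a : A -> bool) (s : seq A) : lazy_has a s = has a s.
Proof. by elim: s => //= x s ->. Qed.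

Lemma lazy_allE (A : Type) (a : A -> bool) (s : seq A) : lazy_all a s = all a s.
Proof. by rewrite /lazy_all lazy_hasE -all_predC; apply: eq_all => x /=; rewrite negbK. Qed.

(** * Exhaustive search over partially known adjacency matrices *)

Definition entry (M : seq (seq bool)) (i j : nat) : bool :=
  nth false (nth [::] M i) j.

Definition set_entry (M : seq (seq bool)) (i j : nat) (b : bool) :=
  set_nth [::] M i (set_nth false (nth [::] M i) j b).

Lemma entry_set_entry M i j b k l :
  entry (set_entry M i j b) k l =
  if (k == i) && (l == j) then b else entry M k l.
Proof.
rewrite /entry /set_entry nth_set_nth /=; case: eqP => [->|//] /=.
by rewrite nth_set_nth /=; case: eqP.
Qed.

Section Search.
Variables (p minsemi mindeg : nat).
Variable accept : seq (seq bool) -> bool.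

Let idx := iota 0 p.

(** Only 4-cycles through the new arc [u v] can have appeared. The nested conditionals replace [&&],
    whose second argument would be evaluated in any case under call by value. *)
Definition closes_4cycle (M : seq (seq bool)) (u v : nat) : bool :=
  lazy_has (fun a => if entry M v a then
      if a == u then false else
      lazy_has (fun b => if entry M a b then
        if entry M b u then b != v else false else false) idx
    else false) idx.

Definition low_degree (N : seq (seq bool)) (u : nat) : bool :=
  let o := count (entry N u) idx in
  let i := count (fun k => entry N k u) idx in
  [|| o < minsemi, i < minsemi | i + o < mindeg].

(* [M] and [N] are the arcs known to be present and the arcs not known to be
   absent; [arcs] lists the undecided ones. *)
Fixpoint search (arcs : seq (nat * nat)) (M N : seq (seq bool)) : bool :=
  match arcs with
  | [::] => (M == N) && accept M
  | (u, v) :: arcs' =>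
      (let M' := set_entry M u v true in
       if closes_4cycle M' u v then true else search arcs' M' N) &&
      (let N' := set_entry N u v false in
       if low_degree N' u then true else
       if low_degree N' v then true else search arcs' M N')
  end.

(** The relation [d] stays between [M] and [N]. At [(u, v)] the branch that agrees with [d u v] is
    never cut: a 4-cycle of [M] would be one of [d], and a low degree in [N] would be low in [d]. At
    the leaf, [M == N] squeezes [d]. *)
Lemma searchP (d : rel nat) arcs M N :
  (forall i, i < p -> ~~ d i i) ->
  (forall u v a b, u < p -> v < p -> a < p -> b < p ->
     d u v -> d v a -> d a b -> d b u -> a != u -> b != v -> False) ->
  (forall i, i < p -> minsemi <= count (d i) idx) ->
  (forall i, i < p -> minsemi <= count (d^~ i) idx) ->
  (forall i, i < p -> mindeg <= count (d^~ i) idx + count (d i) idx) ->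
  (forall a, a \in arcs -> (a.1 < p) && (a.2 < p)) ->
  (forall i j, i < p -> j < p -> entry M i j -> d i j) ->
  (forall i j, i < p -> j < p -> d i j -> entry N i j) ->
  search arcs M N ->
  exists2 L, accept L & forall i j, i < p -> j < p -> entry L i j = d i j.
Proof.
move=> d_irr no4 dout din ddeg.
have le_count (a b : pred nat) : (forall k, k < p -> a k -> b k) ->
    count a idx <= count b idx.
  move=> ab; have idxP k : k \in idx -> k < p by rewrite mem_iota.
  elim: idx idxP => //= k s IHs sP; rewrite leq_add //; last first.
    by apply: IHs => l ls; apply: sP; rewrite in_cons ls orbT.
  by case: (a k) (ab k (sP _ (mem_head _ _))) => // ->.
have notlow N' u : u < p -> (forall i j, i < p -> j < p -> d i j -> entry N' i j) ->
    low_degree N' u = false.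
  move=> up dN.
  have lo : count (d u) idx <= count (entry N' u) idx.
    by apply: le_count => k kp; apply: dN.
  have li : count (d^~ u) idx <= count (fun k => entry N' k u) idx.
    by apply: le_count => k kp; apply: dN.
  rewrite /low_degree !ltnNge (leq_trans (dout _ up) lo) (leq_trans (din _ up) li).
  by rewrite (leq_trans (ddeg _ up) (leq_add li lo)).
elim: arcs M N => [|[u v] arcs IH] M N arcsP Md dN /=.
  case/andP=> /eqP MN accM; exists M => // i j ip jp.
  by apply/idP/idP; [apply: Md | rewrite MN; apply: dN].
have /andP[/= up vp] := arcsP (u, v) (mem_head _ _).
have {}arcsP a : a \in arcs -> (a.1 < p) && (a.2 < p).
  by move=> aP; apply: arcsP; rewrite in_cons aP orbT.
case/andP; case duv: (d u v).
  have Md' i j : i < p -> j < p -> entry (set_entry M u v true) i j -> d i j.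
    by move=> ip jp; rewrite entry_set_entry; case: ifP => [/andP[/eqP-> /eqP->]|_ /Md]; auto.
  move=> H _; apply: (IH _ _ arcsP Md' dN); move: H; case: ifP => // H _.
  exfalso; move: H; rewrite /closes_4cycle lazy_hasE => /hasP[a].
  rewrite mem_iota => /= ap; case: ifP => // /Md'-/(_ vp ap) dva; case: eqP => // /eqP au.
  rewrite lazy_hasE => /hasP[b]; rewrite mem_iota => /= bp.
  case: ifP => // /Md'-/(_ ap bp) dab; case: ifP => // /Md'-/(_ bp up) dbu bv.
  exact: no4 duv dva dab dbu au bv.
have dN' i j : i < p -> j < p -> d i j -> entry (set_entry N u v false) i j.
  move=> ip jp dij; rewrite entry_set_entry; case: ifP => [/andP[/eqP iu /eqP jv]|_].
    by rewrite iu jv duv in dij.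
  exact: dN.
by move=> _; rewrite !notlow //; apply: IH.
Qed.

End Search.

Definition matrix_of (p : nat) (r : rel nat) : seq (seq bool) :=
  mkseq (fun i => mkseq (r i) p) p.

Lemma entry_matrix_of p (r : rel nat) i j :
  i < p -> j < p -> entry (matrix_of p r) i j = r i j.
Proof. by move=> ip jp; rewrite /entry nth_mkseq // nth_mkseq. Qed.

(** Pairs come by increasing larger end [j], both directions side by side: the arcs among the first
    vertices are decided before a new vertex enters, so 4-cycles show up early. *)
Definition search_from (p minsemi mindeg : nat) (accept : seq (seq bool) -> bool)
    (known : seq (nat * nat)) : bool :=
  search p minsemi mindeg accept
    [seq a <- flatten [seq flatten [seq [:: (i, j); (j, i)] | i <- iota 0 j]
                      | j <- iota 0 p] | a \notin known]
    (matrix_of p (fun i j => (i, j) \in known))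
    (matrix_of p (fun i j => i != j)).

(** * From search results to digraphs and isomorphisms *)

Lemma has_4cycle (T : finType) (D : rel T) x y z w : irreflexive D ->
  D x y -> D y z -> D z w -> D w x -> x != z -> y != w -> has_cycle D 4.
Proof.
move=> irrD xy yz zw wx xz yw; exists [:: x; y; z; w]; split=> //=.
  by rewrite xy yz zw wx.
have neq a b : D a b -> a != b by apply: contraTneq => ->; rewrite irrD.
by rewrite !inE !negb_or xz yw (neq _ _ xy) (neq _ _ yz) (neq _ _ zw) (eq_sym x) (neq _ _ wx).
Qed.

(** The list [s] numbers the vertices. It may be chosen so that prescribed arcs are present; [known]
    records these, which breaks symmetry and shortens the search. *)
Lemma search_fromP (T : finType) (D : rel T) (x0 : T) (s : seq T)
    (minsemi mindeg : nat) accept (known : seq (nat * nat)) :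
  irreflexive D -> ~ has_cycle D 4 ->
  (forall x, minsemi <= indeg D x) -> (forall x, minsemi <= outdeg D x) ->
  (forall x, mindeg <= deg D x) ->
  uniq s -> size s = #|T| ->
  (forall a, a \in known -> D (nth x0 s a.1) (nth x0 s a.2)) ->
  search_from #|T| minsemi mindeg accept known ->
  exists2 L, accept L & forall i j, i < #|T| -> j < #|T| ->
    entry L i j = D (nth x0 s i) (nth x0 s j).
Proof.
move=> irrD no4 din dout ddeg us szs knownP.
set d : rel nat := fun i j => D (nth x0 s i) (nth x0 s j).
have perm_s : perm_eq s (enum T).
  have [_ sT] := uniq_min_size us (fun x _ => mem_enum T x)
    (eq_leq (etrans (esym (cardE T)) (esym szs))).
  by apply: uniq_perm; rewrite ?enum_uniq.
have cnt (P : pred T) : count (fun k => P (nth x0 s k)) (iota 0 #|T|) = #|[set y | P y]|.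
  rewrite cardsE cardE /enum_mem size_filter -enumT -(permP perm_s).
  rewrite -[in RHS](mkseq_nth x0 s) count_map szs.
  exact: eq_count.
have cnto i : count (d i) (iota 0 #|T|) = outdeg D (nth x0 s i)
    by exact: (cnt (D (nth x0 s i))).
have cnti i : count (d^~ i) (iota 0 #|T|) = indeg D (nth x0 s i)
    by exact: (cnt (D^~ (nth x0 s i))).
apply: searchP => //.
- by move=> i _; rewrite /d irrD.
- move=> u v a b ul vl al bl duv dva dab dbu au bv; apply: no4.
  apply: (has_4cycle irrD duv dva dab dbu); first by rewrite nth_uniq ?szs // eq_sym.
  by rewrite nth_uniq ?szs // eq_sym.
- by move=> i _; rewrite cnto.
- by move=> i _; rewrite cnti.
- by move=> i _; rewrite cnti cnto; exact: ddeg.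
- move=> [a1 a2]; rewrite mem_filter => /andP[_ /flattenP[? /mapP[j]]].
  rewrite mem_iota /= => jl -> /flattenP[? /mapP[i]]; rewrite mem_iota /= => il ->.
  rewrite !inE !xpair_eqE => /orP[] /andP[/eqP-> /eqP->]; rewrite jl ?andbT /=;
    exact: ltn_trans il jl.
- by move=> i j il jl; rewrite entry_matrix_of // => /knownP.
- move=> i j il jl dij; rewrite entry_matrix_of //.
  by apply: contraTneq dij => ->; rewrite /d irrD.
Qed.

Lemma isomorphic_enum (T S : finType) (D : rel T) (E : rel S) (x0 : T) (s : seq T)
    (n : nat) (g : 'I_n -> S) :
  uniq s -> size s = n -> #|T| = n -> bijective g ->
  (forall i j : 'I_n, D (nth x0 s i) (nth x0 s j) = E (g i) (g j)) ->
  isomorphic D E.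
Proof.
move=> us szs cT bg DE.
have sT x : x \in s.
  have [_ ->] := uniq_min_size us (fun x _ => mem_enum T x)
    (eq_leq (etrans (esym (cardE T)) (etrans cT (esym szs)))).
  by rewrite mem_enum.
have ltx x : index x s < n by rewrite -szs index_mem.
exists (fun x => g (Ordinal (ltx x))).
  apply: (bij_comp bg); exists (fun i : 'I_n => nth x0 s i).
    by move=> x /=; rewrite nth_index.
  by move=> i; apply: val_inj; rewrite /= index_uniq ?szs.
by move=> x y; rewrite -DE /= !nth_index.
Qed.

Lemma nth_comp_enum (T : finType) (x0 : T) (s : seq T) (q : seq nat) (n : nat) :
  uniq s -> size s = n -> perm_eq q (iota 0 n) ->
  [/\ uniq [seq nth x0 s k | k <- q], size [seq nth x0 s k | k <- q] = n
    & forall i, i < n -> nth x0 [seq nth x0 s k | k <- q] i = nth x0 s (nth 0 q i)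
        /\ nth 0 q i < n].
Proof.
move=> us szs pq; have szq : size q = n by rewrite (perm_size pq) size_iota.
have qn k : k \in q -> k < n by rewrite (perm_mem pq) mem_iota.
split; last first.
- by move=> i il; rewrite (nth_map 0) ?szq //; split=> //; apply: qn; rewrite mem_nth ?szq.
- by rewrite size_map.
- rewrite map_inj_in_uniq ?(perm_uniq pq) ?iota_uniq // => k l /qn kn /qn ln /eqP.
  by rewrite nth_uniq ?szs // => /eqP.
Qed.

Definition matches (p : nat) (t : seq (seq bool)) (M : seq (seq bool)) (s : seq nat) :=
  lazy_all (fun i => lazy_all (fun j =>
    entry M (nth 0 s i) (nth 0 s j) == entry t i j) (iota 0 p)) (iota 0 p).

Lemma lazy_all_iota (a : pred nat) p : reflect (forall i, i < p -> a i) (lazy_all a (iota 0 p)).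
Proof.
rewrite lazy_allE; apply: (iffP allP) => H i; last by rewrite mem_iota => /H.
by move=> ip; apply: H; rewrite mem_iota.
Qed.

Lemma matches_isomorphic (T S : finType) (D : rel T) (E : rel S) (x0 : T) (s : seq T)
    (q : seq nat) (n : nat) (g : 'I_n -> S) (e : rel nat) L :
  uniq s -> size s = n -> #|T| = n -> bijective g ->
  (forall i j, i < n -> j < n -> entry L i j = D (nth x0 s i) (nth x0 s j)) ->
  (forall i j : 'I_n, E (g i) (g j) = e i j) ->
  perm_eq q (iota 0 n) -> matches n (matrix_of n e) L q ->
  isomorphic D E.
Proof.
move=> us szs cT bg LD Ee pq /lazy_all_iota mL.
have [us' szs' nths'] := nth_comp_enum x0 us szs pq.
apply: (isomorphic_enum (x0 := x0) us' szs' cT bg) => i j.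
have [-> qi] := nths' i (ltn_ord i); have [-> qj] := nths' j (ltn_ord j).
rewrite -LD // Ee -(entry_matrix_of e (ltn_ord i) (ltn_ord j)).
by have /lazy_all_iota/(_ j (ltn_ord j))/eqP := mL i (ltn_ord i).
Qed.

(** * Order five without 4-cycles *)

Definition two_triangles_rel : rel nat :=
  fun i j => (i != j) && [|| i == 4, j == 4 | (i < 2) == (j < 2)].

Definition cycle_rel (k : nat) : rel nat :=
  fun i j => (j == i.+1 %% k) || (i == j.+1 %% k).

Definition accept5 (M : seq (seq bool)) : bool :=
  let Q := matrix_of 5 (cycle_rel 5) in
  let K := matrix_of 5 two_triangles_rel in
  lazy_has (fun q => if matches 5 Q M q then true else matches 5 K M q)
    (permutations (iota 0 5)).

(** For p = 5 the bound p/2 - 1 on semidegrees rounds up to 2, which already gives total degree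
    4. *)
Lemma search5 : search_from 5 2 4 accept5 [::].
Proof. by vm_compute. Qed.

(** The list has four items only: vertex 4, common to the two triangles 0 1 4 and 2 3 4, is reached
    through the default value of [nth]. *)
Definition two_triangles_vertex (i : 'I_5) : 'I_2 + 'I_2 + 'I_1 :=
  nth (inr ord0) [:: inl (inl ord0); inl (inl ord_max); inl (inr ord0);
                     inl (inr ord_max)] i.

Lemma two_triangles_vertex_bij : bijective two_triangles_vertex.
Proof.
apply: inj_card_bij; last by rewrite !card_sum !card_ord.
by case=> [[|[|[|[|[|//]]]]] ?] [[|[|[|[|[|//]]]]] ?] //= _; apply: val_inj.
Qed.

Lemma order5_no4cycle (T : finType) (D : rel T) :
  irreflexive D -> #|T| = 5 -> ~ has_cycle D 4 ->
  (forall x, 2 <= indeg D x) -> (forall x, 2 <= outdeg D x) ->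
  isomorphic D (@cycle_graph 5) \/
  isomorphic D (join (disjoint_union (@complete 2) (@complete 2)) (@complete 1)).
Proof.
move=> irrD cT no4 din dout.
have /card_gt0P[x0 _] : 0 < #|T| by rewrite cT.
have szs : size (enum T) = 5 by rewrite -cardE cT.
have ddeg x : 4 <= deg D x by apply: (@leq_add 2 2).
have S5 : search_from #|T| 2 4 accept5 [::] by rewrite cT search5.
have [//|L accL LD] := search_fromP (x0 := x0) irrD no4 din dout ddeg (enum_uniq T)
  (esym (cardE T)) _ S5.
rewrite cT in LD; move: accL; rewrite /accept5 lazy_hasE => /hasP[q].
rewrite mem_permutations => pq; case: ifP => [mL _|_ mL]; [left|right].
- exact: (matches_isomorphic (enum_uniq T) szs cT (Bijective (g := id) _ _) LD _ pq mL).
- apply: (matches_isomorphic (enum_uniq T) szs cT two_triangles_vertex_bij LD _ pq mL).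
  by case=> [[|[|[|[|[|//]]]]] ?] [[|[|[|[|[|//]]]]] ?].
Qed.

(** * Order six without 4-cycles *)

Lemma sum_outdeg (T : finType) (D : rel T) : \sum_x outdeg D x = \sum_x indeg D x.
Proof.
have E (P : T -> pred T) : \sum_x #|[set y | P x y]| = \sum_x \sum_y P x y.
  by apply: eq_bigr => x _; rewrite -sum1dep_card big_mkcond.
by rewrite /outdeg /indeg (E D) (E (fun x y => D y x)) exchange_big.
Qed.

Lemma uniq_extend_enum (T : finType) (s : seq T) : uniq s ->
  exists2 r, uniq (s ++ r) & size (s ++ r) = #|T|.
Proof.
move=> us; exists [seq y <- enum T | y \notin s].
  rewrite cat_uniq us filter_uniq ?enum_uniq // andbT.
  by apply/hasPn => y; rewrite mem_filter => /andP[].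
rewrite size_cat size_filter cardE -(count_predC (mem s) (enum T)).
congr (_ + _); rewrite -size_filter; apply/eqP; rewrite eqn_leq; apply/andP; split; last first.
  by apply: uniq_leq_size (filter_uniq _ (enum_uniq T)) _ => y; rewrite mem_filter => /andP[].
by apply: uniq_leq_size => // y ys; rewrite mem_filter mem_enum andbT.
Qed.

(* Vertices 0, 1, 2 of [M], renumbered along [s], form the set F of the
   definition of H(3,3). *)
Definition matches_H (M : seq (seq bool)) (s : seq nat) : bool :=
  let e i j := entry M (nth 0 s i) (nth 0 s j) in
  if lazy_all (fun i => lazy_all (fun j =>
       if (i < 3) == (j < 3) then e i j == (i != j)
       else if 2 < i then ~~ e i j else true) (iota 0 6)) (iota 0 6)
  then lazy_all (fun i => lazy_has (e i) (iota 3 3)) (iota 0 3) &&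
       lazy_all (fun i => lazy_has (e^~ i) (iota 0 3)) (iota 3 3)
  else false.

(** F consists of the vertices at the first three places of the renumbered list, and B is its
    complement. *)
Lemma matches_H_in_H (T : finType) (D : rel T) (x0 : T) (s : seq T) (q : seq nat) L :
  uniq s -> size s = 6 -> #|T| = 6 ->
  (forall i j, i < 6 -> j < 6 -> entry L i j = D (nth x0 s i) (nth x0 s j)) ->
  perm_eq q (iota 0 6) -> matches_H L q -> in_H 3 D.
Proof.
move=> us szs cT LD pq; rewrite /matches_H; case: ifP => // /lazy_all_iota H1.
case/andP; rewrite !lazy_allE => /allP H2 /allP H3.
have [us' szs' nths'] := nth_comp_enum x0 us szs pq.
set s' := map _ q in us' szs' nths'.
have LD' i j : i < 6 -> j < 6 ->
    entry L (nth 0 q i) (nth 0 q j) = D (nth x0 s' i) (nth x0 s' j).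
  by move=> /nths'[-> qi] /nths'[-> qj]; apply: LD.
have s'T x : x \in s'.
  have [_ ->] := uniq_min_size us' (fun x _ => mem_enum T x)
    (eq_leq (etrans (esym (cardE T)) (etrans cT (esym szs')))).
  by rewrite mem_enum.
have idx6 x : index x s' < 6 by rewrite -szs' index_mem.
have DE x y : D x y = entry L (nth 0 q (index x s')) (nth 0 q (index y s')).
  by rewrite LD' // !nth_index.
have cardF : #|[set x | index x s' < 3]| = 3.
  have -> : [set x | index x s' < 3] = [set x in take 3 s'].
    by apply/setP => x; rewrite !inE in_take.
  by rewrite cardsE (card_uniqP _) ?take_uniq // size_take szs'.
split=> //; split; first by rewrite cT.
exists [set x | index x s' < 3], (~: [set x | index x s' < 3]).
split; first by split; rewrite ?setUCr // cardsCs setCK cardF cT.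
have eqi x y : (index x s' == index y s') = (x == y).
  by apply/eqP/eqP => [|-> //]; move/(congr1 (nth x0 s')); rewrite !nth_index.
split=> [x y|x y|x y|x|y]; rewrite !inE -?leqNgt => xF.
- move=> yF; have /lazy_all_iota/(_ _ (idx6 y)) := H1 _ (idx6 x).
  by rewrite xF yF eqxx -DE eqi => /eqP.
- move=> yF; have /lazy_all_iota/(_ _ (idx6 y)) := H1 _ (idx6 x).
  by rewrite !(ltnNge _ 3) xF yF eqxx -DE eqi => /eqP.
- move=> yF; have /lazy_all_iota/(_ _ (idx6 y)) := H1 _ (idx6 x).
  by rewrite (ltnNge _ 3) xF yF /= -DE.
- have := H2 (index x s'); rewrite mem_iota lazy_hasE => /(_ xF)/hasP[j].
  rewrite mem_iota => /andP[j3 j6] Lxj; exists (nth x0 s' j).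
    by rewrite !inE index_uniq ?szs' // -leqNgt.
  by rewrite DE index_uniq ?szs'.
- have := H3 (index y s'); rewrite mem_iota lazy_hasE xF => /(_ (idx6 y))/hasP[j].
  rewrite mem_iota => /= j3 Ljy; have j6 : j < size s' by rewrite szs' (ltn_trans j3).
  by exists (nth x0 s' j); rewrite ?inE ?DE index_uniq.
Qed.

(** The arcs of [H6'], with x, y, z, u, v, w numbered 0 to 5, are listed again because the matrices
    are indexed by natural numbers and not by ['I_6]. The next two lists do the same for [H6''] and
    [H6''']. *)
Definition arcs_H6' : seq (nat * nat) :=
  cycle_arcs [:: 0; 4; 5; 3; 1; 2] ++
  reverse_arcs (cycle_arcs [:: 0; 4; 5; 3; 1; 2]) ++
  [:: (0, 1); (0, 5); (2, 3); (4, 3)].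

Definition arcs_H6'' : seq (nat * nat) :=
  cycle_arcs [:: 0; 1; 4; 2; 5; 3] ++
  [:: (0, 4); (4, 0); (0, 3); (0, 5); (3, 2);
      (1, 3); (1, 2); (2, 1); (5, 2); (5, 4)].

Definition arcs_H6''' : seq (nat * nat) :=
  cycle_arcs [:: 0; 5; 4; 2; 1; 3] ++
  [:: (0, 1); (1, 4); (4, 0); (3, 2); (2, 5);
      (5, 3); (0, 3); (1, 2); (4, 5)].

Definition arc_matrix (s : seq (nat * nat)) : seq (seq bool) :=
  matrix_of 6 (fun i j => (i, j) \in s).

(* In a member of H(3,3) the vertices of F are those of outdegree at least 3. *)
Definition accept6 (M : seq (seq bool)) : bool :=
  let big i := 2 < count (entry M i) (iota 0 6) in
  if matches_H M (filter big (iota 0 6) ++ filter (predC big) (iota 0 6)) then true else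
  let H1 := arc_matrix arcs_H6' in
  let H2 := arc_matrix arcs_H6'' in
  let H3 := arc_matrix arcs_H6''' in
  lazy_has (fun q => if matches 6 H1 M q then true else
                     if matches 6 H2 M q then true else matches 6 H3 M q)
    (permutations (iota 0 6)).

(** Some vertex has outdegree at least 3: it receives number 0, and three of its out-neighbours
    receive 1, 2, 3. *)
Lemma search6 : search_from 6 2 5 accept6 [:: (0, 1); (0, 2); (0, 3)].
Proof. by vm_compute. Qed.

Lemma order6_no4cycle (T : finType) (D : rel T) :
  irreflexive D -> #|T| = 6 -> ~ has_cycle D 4 ->
  (forall x, 2 <= indeg D x) -> (forall x, 2 <= outdeg D x) ->
  (forall x, 5 <= deg D x) ->
  [\/ in_H 3 D, isomorphic D H6', isomorphic D H6'' | isomorphic D H6'''].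
Proof.
move=> irrD cT no4 din dout ddeg.
(* If all outdegrees were at most 2, all indegrees would be at least 5 - 2 = 3, while both sums
   count the arcs. *)
have [x0 dx0] : exists x, 2 < outdeg D x.
  apply/existsP; apply: contraT => /existsPn small.
  have : \sum_x outdeg D x < \sum_x indeg D x; last by rewrite sum_outdeg ltnn.
  apply: (@leq_ltn_trans (\sum_(x : T) 2)).
    by apply: leq_sum => x _; rewrite leqNgt small.
  apply: (@leq_trans (\sum_(x : T) 3)); first by rewrite !sum_nat_const cT.
  apply: leq_sum => x _; have := ddeg x; have := small x.
  by rewrite -leqNgt /deg => o2 d5; rewrite -(leq_add2r 2) (leq_trans d5) // leq_add2l.
have [y [z [w [xy xz xw /and3P[yz yw zw]]]]] : exists y z w,
    [/\ D x0 y, D x0 z, D x0 w & [&& y != z, y != w & z != w]].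
  have := enum_uniq [set y | D x0 y].
  have memO v : v \in enum [set y | D x0 y] -> D x0 v by rewrite mem_enum inE.
  move: dx0; rewrite /outdeg cardE; case: (enum _) memO => [|y [|z [|w s]]] // memO _ /=.
  rewrite !inE !negb_or => /and3P[/and3P[yz yw _] /andP[zw _] _].
  exists y, z, w; split; rewrite ?yz ?yw ?zw //; apply: memO;
    by rewrite !inE eqxx ?orbT.
have neqx v : D x0 v -> x0 != v by apply: contraTneq => <-; rewrite irrD.
have us : uniq [:: x0; y; z; w] by rewrite /= !inE !negb_or !neqx // yz yw zw.
have [r ur szr] := uniq_extend_enum us.
have S6 : search_from #|T| 2 5 accept6 [:: (0, 1); (0, 2); (0, 3)] by rewrite cT search6.
have knownP a : a \in [:: (0, 1); (0, 2); (0, 3)] ->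
    D (nth x0 ([:: x0; y; z; w] ++ r) a.1) (nth x0 ([:: x0; y; z; w] ++ r) a.2).
  by rewrite !inE => /or3P[] /eqP->.
have [L accL LD] := search_fromP irrD no4 din dout ddeg ur szr knownP S6.
rewrite cT in LD szr; move: accL; rewrite /accept6; case: ifP => [mH _|_].
  apply: Or41; apply: (matches_H_in_H ur szr cT LD _ mH).
  by rewrite (perm_filterC _ (iota 0 6)).
rewrite lazy_hasE => /hasP[q]; rewrite mem_permutations => pq.
case: ifP => [mL _|_]; last case: ifP => [mL _|_ mL].
- apply: Or42; exact: (matches_isomorphic ur szr cT (Bijective (g := id) _ _) LD _ pq mL).
- apply: Or43; exact: (matches_isomorphic ur szr cT (Bijective (g := id) _ _) LD _ pq mL).
- apply: Or44; exact: (matches_isomorphic ur szr cT (Bijective (g := id) _ _) LD _ pq mL).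
Qed.

(** * Digraphs without 4-cycles on at least seven vertices *)

(* Clearing the other hypotheses first makes [lia] much faster. *)
Ltac nat_lia := repeat match goal with
  | H : ?P |- _ => lazymatch P with
    | is_true (leq _ _) => fail | @eq nat _ _ => fail | (_ /\ _) => fail | _ => clear H end
  end; lia.

Definition outs (T : finType) (D : rel T) (x : T) : {set T} := [set y | D x y].
Definition ins (T : finType) (D : rel T) (x : T) : {set T} := [set y | D y x].

(** Without loops consecutive vertices are distinct, so only the two opposite pairs need a
    condition. *)
Definition no_4cycle (T : finType) (D : rel T) : Prop := forall x y z w,
  D x y -> D y z -> D z w -> D w x -> x != z -> y != w -> False.

Lemma no_4cycle_rev (T : finType) (D : rel T) : no_4cycle D -> no_4cycle (fun x y => D y x).
Proof. by move=> no4 x y z w xy yz zw wx xz yw; apply: (no4 y x w z); rewrite // eq_sym. Qed.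

Section No4Cycle.
Variables (T : finType) (D : rel T).
Hypotheses (irrD : irreflexive D) (no4 : no_4cycle D).

Lemma arc_neq x y : D x y -> x != y.
Proof. by apply: contraTneq => ->; rewrite irrD. Qed.

Lemma no_arc_outs_ins x y a b : D x y -> a \in outs D y :\ x -> b \in ins D x :\ y ->
  D a b = false.
Proof.
rewrite !inE => xy /andP[ax ya] /andP[by_ bx]; apply/negP => ab.
by apply: (no4 xy ya ab bx); rewrite eq_sym.
Qed.

(** Arcs from [a] to the in-neighbours of [x] other than [y] are excluded by [no_arc_outs_ins]; an
    arc from [a] to [x] would make [a] itself such an in-neighbour. *)
Lemma outs_sub x y a : D x y -> a \in outs D y :\ x -> a \notin ins D x :\ y ->
  outs D a \subset ~: (x |: (a |: (ins D x :\ y))).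
Proof.
move=> xy aA aB; apply/subsetP => v; rewrite !inE => av.
have va : v != a by rewrite eq_sym arc_neq.
have [eyv|vy] /= := eqVneq v y.
  by rewrite eyv in va *; rewrite !negb_or (eq_sym y x) (arc_neq xy) va.
rewrite !negb_or va /=; have [vx|_] := eqVneq v x.
  have ya : a != y by move: aA; rewrite !inE => /andP[_ /arc_neq]; rewrite eq_sym.
  by move: aB; rewrite !inE ya -vx av.
apply/negP => vx; have := no_arc_outs_ins (b := v) xy aA.
by rewrite !inE vy vx av => /(_ isT).
Qed.

Lemma card_outs_sub x y a : D x y -> a \in outs D y :\ x -> a \notin ins D x :\ y ->
  #|~: (x |: (a |: (ins D x :\ y)))| + #|ins D x :\ y| + 2 = #|T|.
Proof.
move=> xy aA aB; have := cardsC (x |: (a |: (ins D x :\ y))).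
rewrite !cardsU1 aB !inE irrD andbF orbF.
by move: aA; rewrite !inE eq_sym => /andP[-> _] /=; nat_lia.
Qed.

Lemma outs_bound x y a : D x y -> a \in outs D y :\ x -> a \notin ins D x :\ y ->
  #|outs D a| + #|ins D x :\ y| + 2 <= #|T|.
Proof.
move=> xy aA aB; have := card_outs_sub xy aA aB.
by have := subset_leq_card (outs_sub xy aA aB); nat_lia.
Qed.

(** Equality case of [outs_bound]: the inclusion [outs_sub] becomes an equality and determines every
    arc leaving [a]. *)
Lemma outs_full x y a v : D x y -> a \in outs D y :\ x -> a \notin ins D x :\ y ->
  #|T| <= #|outs D a| + #|ins D x :\ y| + 2 ->
  D a v = [&& v != x, v != a & v \notin ins D x :\ y].
Proof.
move=> xy aA aB le; have := card_outs_sub xy aA aB => cs.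
have /eqP : outs D a == ~: (x |: (a |: (ins D x :\ y))).
  by rewrite eqEcard (outs_sub xy aA aB); nat_lia.
by move/setP/(_ v); rewrite in_setC !in_setU1 !negb_or inE.
Qed.

Lemma two_paths z z' w w' : z != z' ->
  w \in outs D z :&: ins D z' -> w' \in outs D z' :&: ins D z -> w = w'.
Proof.
rewrite !inE => zz /andP[zw wz] /andP[zw' wz']; apply/eqP/negPn/negP => ww.
exact: no4 zw wz zw' wz' zz ww.
Qed.

(** If both sets are nonempty, [two_paths] identifies each element of one with each element of the
    other, so they are the same singleton. *)
Lemma two_paths_card z z' : z != z' ->
  [\/ outs D z :&: ins D z' = set0, outs D z' :&: ins D z = set0
   | #|outs D z :&: ins D z'| <= 1 /\ #|outs D z' :&: ins D z| <= 1].
Proof.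
move=> zz; have [|[w w1]] := set_0Vmem (outs D z :&: ins D z'); first by apply: Or31.
have [|[w' w2]] := set_0Vmem (outs D z' :&: ins D z); first by apply: Or32.
apply: Or33; split.
  rewrite (_ : _ :&: _ = [set w]) ?cards1 //; apply/setP => v; rewrite in_set1.
  apply/idP/eqP => [v1|-> //]; by rewrite (two_paths zz v1 w2) (two_paths zz w1 w2).
rewrite (_ : _ :&: _ = [set w']) ?cards1 //; apply/setP => v; rewrite in_set1.
apply/idP/eqP => [v1|-> //]; by rewrite -(two_paths zz w1 v1) (two_paths zz w1 w2).
Qed.

(** For an arc [x y], these are the third vertices of the 3-cycles through it. *)
Definition commons x y : {set T} := (outs D y :\ x) :&: (ins D x :\ y).

Lemma commons_sub x y z z' : D x y -> z \in commons x y -> z' \in commons x y ->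
  outs D z :|: ins D z' \subset ~: commons x y.
Proof.
move=> xy; rewrite !in_setI => /andP[zA zB] /andP[z'A z'B].
apply/subsetP => v; rewrite in_setC in_setU in_setI.
have [vA|] := boolP (v \in outs D y :\ x); last by [].
have [vB|] := boolP (v \in ins D x :\ y); last by [].
by rewrite !inE (no_arc_outs_ins xy zA vB) (no_arc_outs_ins xy vA z'B).
Qed.

Hypothesis semi_out : forall x, #|T| <= 2 * #|outs D x| + 2.
Hypothesis semi_in : forall x, #|T| <= 2 * #|ins D x| + 2.
Hypothesis deg_ge : forall x, #|T| <= #|outs D x| + #|ins D x| + 1.

(** With three elements, both unions given by [commons_sub] for distinct [z], [z'] have size at most
    p - 3. If one intersection is empty, the semidegrees make its union at least p - 2. Otherwise
    both intersections have size at most 1, so d(z) + d(z') <= 2(p - 3) + 2 < 2(p - 1). *)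
Lemma card_commons x y : D x y -> #|commons x y| <= 2.
Proof.
move=> xy; rewrite leqNgt; apply/negP => c3.
have /card_gt1P[z [z' [zC z'C zz]]] : 1 < #|commons x y| by apply: ltnW.
have := subset_leq_card (commons_sub xy zC z'C).
have := subset_leq_card (commons_sub xy z'C zC).
have := cardsC (commons x y).
have := cardsUI (outs D z) (ins D z'); have := cardsUI (outs D z') (ins D z).
have := (semi_out z, semi_out z', semi_in z, semi_in z', deg_ge z, deg_ge z').
move=> [[[[[h1 h2] h3] h4] h5] h6].
by case: (two_paths_card zz) => [->|->|[]]; rewrite ?cards0; nat_lia.
Qed.

End No4Cycle.

(** * Impossibility of the symmetric case, and reduction to it *)

Lemma pick_setD (T : finType) (A B : {set T}) : #|A :&: B| < #|A| ->
  exists2 a, a \in A & a \notin B.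
Proof.
move=> lt; have /card_gt0P[a] : 0 < #|A :\: B| by have := cardsID B A; nat_lia.
by rewrite inE => /andP[aB aA]; exists a.
Qed.

Lemma no_4cycle_asym (T : finType) (D : rel T) : irreflexive D -> no_4cycle D ->
  (forall x, #|T| <= 2 * #|outs D x| + 1) -> 7 <= #|T| -> ~ symmetric D.
Proof.
move=> irrD no4 deg_ge T7 symD.
have insE x : ins D x = outs D x by apply/setP => y; rewrite !inE symD.
have /card_gt0P[x _] : 0 < #|T| by nat_lia.
have [y] : exists y, y \in outs D x by apply/card_gt0P; have := deg_ge x; nat_lia.
rewrite inE => xy; have yx : D y x by rewrite symD.
set A := outs D y :\ x; set B := ins D x :\ y.
have cA : #|outs D y| = #|A|.+1 by rewrite (cardsD1 x (outs D y)) inE yx.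
have cB : #|outs D x| = #|B|.+1 by rewrite (cardsD1 y (outs D x)) inE xy /B insE.
have c1 : #|A :&: B| <= 1.
  rewrite leqNgt; apply/negP => /card_gt1P[z [z' [zC z'C zz]]].
  move: zC z'C; rewrite !inE => /andP[/andP[_ yz] /andP[_ zx]] /andP[/andP[_ yz'] /andP[_ z'x]].
  have xz : D x z by rewrite symD.
  have zy : D z y by rewrite symD.
  exact: no4 xz zy yz' z'x (arc_neq irrD xy) zz.
have dx := deg_ge x; have dy := deg_ge y.
(* Here |O(a)| >= (p - 1)/2 and |B| = |O(x)| - 1 >= (p - 3)/2, so [outs_bound] holds with
   equality. *)
have tight a : a \in A -> a \notin B -> #|T| <= #|outs D a| + #|B| + 2.
  by move=> aA aB; have da := deg_ge a; have := outs_bound irrD no4 xy aA aB; rewrite -/B; nat_lia.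
have [a aA aB] : exists2 a, a \in A & a \notin B by apply: pick_setD; nat_lia.
have [b bB bA] : exists2 b, b \in B & b \notin A by apply: pick_setD; rewrite setIC; nat_lia.
have symA : ins D y :\ x = A by rewrite insE.
have symB : outs D x :\ y = B by rewrite -insE.
have tightb : #|T| <= #|outs D b| + #|A| + 2.
  have db := deg_ge b; have := outs_bound (a := b) irrD no4 yx; rewrite symA symB.
  by move=> /(_ bB bA); nat_lia.
have ob := outs_bound (a := b) irrD no4 yx; rewrite symA symB in ob; have {}ob := ob bB bA.
have oa := outs_bound irrD no4 xy aA aB; rewrite -/B in oa.
have outa a' v : a' \in A -> a' \notin B -> D a' v = [&& v != x, v != a' & v \notin B].
  by move=> a'A a'B; apply: (outs_full irrD no4 v xy a'A a'B (tight _ a'A a'B)).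
have outb v : D b v = [&& v != y, v != b & v \notin A].
  by have := outs_full (a := b) irrD no4 v yx; rewrite symA symB; apply.
have da := deg_ge a; have db := deg_ge b.
set R := ~: (x |: (y |: (A :|: B))).
have cR : #|R| + #|A :|: B| + 2 = #|T|.
  rewrite -[RHS](cardsC (x |: (y |: (A :|: B)))) -/R !cardsU1 !inE !irrD.
  rewrite !eqxx (negbTE (arc_neq irrD xy)) /=.
  by rewrite !andbF /=; nat_lia.
have cU := cardsUI A B.
have RP v : v \in R -> [/\ v != x, v != y, v \notin A & v \notin B].
  by rewrite in_setC !in_setU1 in_setU !negb_or => /and4P.
have [e eR] : exists e, e \in R by apply/card_gt0P; nat_lia.
have [ex ey eA eB] := RP e eR.
(* Every vertex of A \ B is joined to [y] and to all of R, so two of them close a 4-cycle with [y]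
   and [e]. *)
have [a2|a1] := leqP 2 #|A :\: B|.
  have /card_gt1P[u [v [/setDP[uA uB] /setDP[vA vB] uv]]] := a2.
  have toe w : w \in A -> w \notin B -> D w e.
    by move=> wA wB; rewrite outa // ex eB andbT /=; apply: contraNneq eA => ->.
  have fromy w : w \in A -> D y w by rewrite !inE => /andP[].
  have eu : D e u by rewrite symD toe.
  have uy : D u y by rewrite symD fromy.
  exact: (no4 e u y v eu uy (fromy v vA) (toe v vA vB) ey uv).
(* Now |A| = |B| = (p - 3)/2 is at most 2, so p = 7, |A n B| = 1 and |R| = 2; the 4-cycle is
   [a e1 b e2]. *)
have /card_gt1P[e1 [e2 [e1R e2R ee]]] : 1 < #|R| by have := cardsID B A; nat_lia.
have ae v : v \in R -> D a v.
  move=> /RP[vx _ vA vB]; rewrite outa // vx vB andbT /=.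
  by apply: contraNneq vA => ->.
have eb v : v \in R -> D v b.
  move=> /RP[_ vy vA vB]; rewrite symD outb // vy vA andbT /=.
  by apply: contraNneq vB => ->.
have be2 : D b e2 by rewrite symD eb.
have e2a : D e2 a by rewrite symD ae.
apply: (no4 a e1 b e2 (ae e1 e1R) (eb e1 e1R) be2 e2a _ ee).
by apply: contraNneq bA => <-.
Qed.

(** An arc [x y] without reverse keeps [x] out of O(y) and [y] out of I(x), so A and B are one
    larger than the symmetric count would give and the semidegree bounds alone are tight. The cases
    are |A n B| = 0, 1, 2. *)
Lemma no_4cycle_sym (T : finType) (D : rel T) : irreflexive D -> no_4cycle D ->
  (forall x, #|T| <= 2 * #|outs D x| + 2) -> (forall x, #|T| <= 2 * #|ins D x| + 2) ->
  (forall x, #|T| <= #|outs D x| + #|ins D x| + 1) -> 7 <= #|T| ->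
  forall x y, D x y -> D y x.
Proof.
move=> irrD no4 semi_out semi_in deg_ge T7 x y xy.
apply: contraT => /negbTE yx; exfalso.
have no4' := no_4cycle_rev no4.
set A := outs D y :\ x; set B := ins D x :\ y.
have xyn := arc_neq irrD xy.
have cA : #|outs D y| = #|A| by rewrite (cardsD1 x (outs D y)) inE yx.
have cB : #|ins D x| = #|B| by rewrite (cardsD1 y (ins D x)) inE yx.
have noAB a b : a \in A -> b \in B -> D a b = false by apply: no_arc_outs_ins.
have c2 : #|A :&: B| <= 2 := card_commons no4 semi_out semi_in deg_ge xy.
have IDA := cardsID B A; have IDB := cardsID A B; rewrite setIC in IDB.
have oy := semi_out y; have ix := semi_in x.
have outa1 v : v \in A -> v \notin B -> #|outs D v| + #|B| + 2 <= #|T|.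
  by move=> vA vB; have := outs_bound irrD no4 xy vA vB.
have inb1 v : v \in B -> v \notin A -> #|ins D v| + #|A| + 2 <= #|T|.
  by move=> vB vA; apply: (@outs_bound _ (fun u v => D v u) irrD no4' y x v xy vB vA).
have [a aA aB] : exists2 a, a \in A & a \notin B by apply: pick_setD; nat_lia.
have [b bB bA] : exists2 b, b \in B & b \notin A by apply: pick_setD; rewrite setIC; nat_lia.
have sa := semi_out a; have sb := semi_in b.
have oa := outa1 a aA aB; have ib := inb1 b bB bA.
(* The terms |O(a)|, |B|, and likewise |I(b)|, |A|, are at least p/2 - 1 with sum at most p - 2;
   hence p is even, so p >= 8, and all four equal p/2 - 1. It follows below that |R| = |A n B|. *)
have [TA TB] : #|T| = 2 * #|A| + 2 /\ #|T| = 2 * #|B| + 2 by nat_lia.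
have toA v w : v \in A -> v \notin B -> D v w = [&& w != x, w != v & w \notin B].
  move=> vA vB; apply: (outs_full irrD no4 w xy vA vB); rewrite -/B; have := semi_out v; nat_lia.
have frB v w : v \in B -> v \notin A -> D w v = [&& w != y, w != v & w \notin A].
  move=> vB vA; apply: (@outs_full _ (fun u v => D v u) irrD no4' y x v w xy vB vA).
  by change (#|T| <= #|ins D v| + #|A| + 2); have := semi_in v; nat_lia.
(* The arcs A \ B -> R -> B \ A -> x -> y -> A \ B are all present, so an arc
   that shortcuts this walk closes a 4-cycle. *)
set R := ~: (x |: (y |: (A :|: B))).
have cR : #|R| + #|A :|: B| + 2 = #|T|.
  rewrite -[RHS](cardsC (x |: (y |: (A :|: B)))) -/R !cardsU1 !inE !irrD !eqxx.
  rewrite (negbTE xyn) /=.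
  by rewrite !andbF /=; nat_lia.
have cU := cardsUI A B.
have RP v : v \in R -> [/\ v != x, v != y, v \notin A & v \notin B].
  by rewrite in_setC !in_setU1 in_setU !negb_or => /and4P.
have yA v : v \in A -> D y v by rewrite !inE => /andP[].
have Bx v : v \in B -> D v x by rewrite !inE => /andP[].
have xA : x \notin A by rewrite !inE eqxx.
have yB : y \notin B by rewrite !inE eqxx.
have yA' : y \notin A by rewrite !inE irrD andbF.
have xB' : x \notin B by rewrite !inE irrD andbF.
have neqS (S : {set T}) u v : u \in S -> v \notin S -> u != v.
  by move=> uS; apply: contraNneq => <-.
have aR v w : v \in A -> v \notin B -> w \in R -> D v w.
  by move=> vA vB /RP[wx _ wA wB]; rewrite toA // wx wB andbT eq_sym (neqS A).
have Rb v w : v \in B -> v \notin A -> w \in R -> D w v.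
  by move=> vB vA /RP[_ wy wA wB]; rewrite frB // wy wA andbT eq_sym (neqS B).
have ay v : v \in A -> v \notin B -> D v y.
  by move=> vA vB; rewrite toA // yB andbT eq_sym xyn eq_sym (neqS A).
have xb v : v \in B -> v \notin A -> D x v.
  by move=> vB vA; rewrite frB // xA andbT xyn eq_sym (neqS B).
have Rx e : e \in R -> D e x = false.
  move=> eR; have [ex ey eA eB] := RP e eR; apply/negP => e1.
  apply: (no4 x y a e xy (yA a aA) (aR a e aA aB eR) e1); last by rewrite eq_sym.
  by rewrite eq_sym (neqS A).
have Ry e : e \in R -> D y e = false.
  by case/RP=> ex _ eA _; apply/negP => ye; move: eA; rewrite !inE ex ye.
case c: #|A :&: B| c2 => [|[|[|//]]] _.
(* Disjoint A and B: A is complete symmetric with at least three vertices, all joined to [y] in both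
   directions. *)
- have AB v : v \in A -> v \notin B.
    move=> vA; apply/negP => vB; have : v \in A :&: B by rewrite inE vA.
    by rewrite (cards0_eq c) inE.
  have /card_gt2P[u [v [w [[uA vA wA] [uv vw wu]]]]] : 2 < #|A| by nat_lia.
  have inA t t' : t \in A -> t' \in A -> t != t' -> D t t'.
    by move=> tA t'A tt; rewrite toA ?AB // (eq_sym t' t) tt (neqS A t' x).
  apply: (no4 y u v w (yA u uA) (inA u v uA vA uv) (inA v w vA wA vw) (ay w wA (AB w wA))).
    by rewrite eq_sym (neqS A).
  by rewrite eq_sym.
(* One common vertex, R = {e}: the arcs at [e] go only from A and to B, so d(e) <= |A| + |B| = p -
   2. *)
- have /card_gt1P[u [v [/setDP[uA uB] /setDP[vA vB] uv]]] : 1 < #|A :\: B| by nat_lia.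
  have /card_gt1P[s [t [/setDP[sB sA] /setDP[tB tA] st]]] : 1 < #|B :\: A| by nat_lia.
  have /cards1P[e eR] : #|R| == 1 by apply/eqP; nat_lia.
  have eRe : e \in R by rewrite eR set11.
  have [ex ey eA eB] := RP e eRe.
  have cover w : [\/ w = x, w = y, w = e | w \in A :|: B].
    have [->|wx] := eqVneq w x; first by apply: Or41.
    have [->|wy] := eqVneq w y; first by apply: Or42.
    have [wAB|wAB] := boolP (w \in A :|: B); first by apply: Or44.
    have : w \in R by rewrite in_setC !in_setU1 !negb_or wx wy.
    by rewrite eR in_set1 => /eqP; apply: Or43.
  have outE : outs D e \subset B.
    apply/subsetP => w; rewrite inE => ew; apply: contraT => wB.
    have [ewx|ewy|ewe|] := cover w.
    - by rewrite ewx Rx in ew.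
    - rewrite ewy in ew.
      have vu : D v u by rewrite toA // uB (neqS A) // uv.
      by case: (no4 y v u e (yA v vA) vu (aR u e uA uB eRe) ew); rewrite 1?(eq_sym y) (neqS A).
    - by rewrite ewe irrD in ew.
    rewrite in_setU (negbTE wB) orbF => wA.
    have [k [kA kB kw]] : exists k, [/\ k \in A, k \notin B & w != k].
      have [wu|wu] := eqVneq w u; last by exists u.
      by exists v; rewrite wu.
    by case: (no4 e w y k ew (ay w wA wB) (yA k kA) (aR k e kA kB eRe) ey kw).
  have inE' : ins D e \subset A.
    apply/subsetP => w; rewrite inE => we; apply: contraT => wA.
    have [ewx|ewy|ewe|] := cover w.
    - rewrite ewx in we.
      have st' : D s t by rewrite frB // sA (neqS B) // st.
      have xs : x != s by rewrite eq_sym (neqS B).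
      have et : e != t by rewrite eq_sym (neqS B).
      by case: (no4 x e s t we (Rb s e sB sA eRe) st' (Bx t tB) xs et).
    - by rewrite ewy Ry in we.
    - by rewrite ewe irrD in we.
    rewrite in_setU (negbTE wA) /= => wB.
    have [k [kB kA kw]] : exists k, [/\ k \in B, k \notin A & k != w].
      have [wu|wu] := eqVneq w s; last by exists s; rewrite eq_sym.
      by exists t; rewrite wu eq_sym.
    by case: (no4 e k x w (Rb k e kB kA eRe) (Bx k kB) (xb w wB wA) we ex kw).
  have := deg_ge e; have := subset_leq_card outE; have := subset_leq_card inE'.
  by nat_lia.
have [e eR] : exists e, e \in R by apply/card_gt0P; nat_lia.
have [ex ey eA eB] := RP e eR.
have ab : a != b by apply: (neqS A).
have csub z z' : z \in A :&: B -> z' \in A :&: B ->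
    outs D z :|: ins D z' \subset ~: (A :&: B) by apply: commons_sub.
have full z z' : z \in A :&: B -> z' \in A :&: B ->
    #|T| <= #|outs D z :|: ins D z'| + 2 ->
    (forall v, v \in A -> v \notin B -> D z v) /\ (forall v, v \in B -> v \notin A -> D v z').
  move=> zC z'C le; have /eqP E : outs D z :|: ins D z' == ~: (A :&: B).
    rewrite eqEcard (csub z z' zC z'C).
    by have := cardsC (A :&: B); nat_lia.
  move: zC z'C; rewrite !in_setI => /andP[zA zB] /andP[z'A z'B].
  split=> v vA vB; have := in_setC v (A :&: B); rewrite -E in_setI vA (negbTE vB) !inE /=.
    by rewrite (noAB v z') // orbF.
  by rewrite (noAB z v).
have no_back z v : z \in A :&: B -> D z a -> v \in B -> v \notin A -> D v z = false.
  rewrite in_setI => /andP[zA _] za vB vA; apply/negP => vz.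
  apply: (no4 z a e v za (aR a e aA aB eR) (Rb v e vB vA eR) vz).
    exact: (neqS A).
  by rewrite eq_sym (neqS B).
(* If the intersection is empty, the union is tight, so [z] dominates A \ B and by [no_back] I(z)
   lies in {x, y} u R. Tightness also gives |O(z)| <= p/2 - 1, hence |I(z)| >= p/2 and p = 8. *)
have disj z z' : z \in A :&: B -> z' \in A :&: B -> z != z' ->
    outs D z :&: ins D z' != set0.
  move=> zC z'C zz; apply/eqP => S0.
  have U := cardsUI (outs D z) (ins D z'); rewrite S0 cards0 in U.
  have [oz iz'] := (semi_out z, semi_in z').
  have [za _] : (forall v, v \in A -> v \notin B -> D z v) /\
      (forall v, v \in B -> v \notin A -> D v z').
    by apply: full => //; nat_lia.
  have CE : A :&: B = [set z; z'].
    by apply/esym/eqP; rewrite eqEcard cards2 zz c andbT; apply/subsetP => v /set2P[] ->.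
  have := zC; rewrite in_setI => /andP[zA zB].
  have := z'C; rewrite in_setI => /andP[z'A z'B].
  have insz : ins D z \subset x |: (y |: R).
    apply/subsetP => w; rewrite inE => wz.
    rewrite in_setU1 in_setU1; have [//|wx] := eqVneq w x; have [//|wy] := eqVneq w y.
    rewrite in_setC !in_setU1 in_setU !negb_or wx wy /=; apply/andP; split.
      by apply: contraTN wz => wA; rewrite noAB.
    apply: contraTN wz => wB; have [wA|wA] := boolP (w \in A); first by rewrite noAB.
    by rewrite no_back // za.
  have := subset_leq_card insz; rewrite !cardsU1 => iz.
  have dz := deg_ge z.
  have bz : #|outs D z :|: ins D z'| + 2 <= #|T|.
    by have := subset_leq_card (csub z z' zC z'C); have := cardsC (A :&: B); nat_lia.
  have iz4 : #|ins D z| <= 4.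
    by move: iz; case: (_ \notin _); case: (_ \notin _); nat_lia.
  (* With p = 8, |A| = 3 and |A n B| = 2. Then I(y) has at most 3 elements and O(y) has 3, against
     d(y) >= 7. *)
  have /cards1P[a' a'E] : #|A :\: B| == 1 by apply/eqP; nat_lia.
  have insy : ins D y \subset [set x; z'; a].
    apply/subsetP => w; rewrite inE => wy.
    have [->|wx] := eqVneq w x; first by rewrite !inE eqxx.
    have [wA|wA] := boolP (w \in A).
      have [wB|wB] := boolP (w \in B).
        have : w \in A :&: B by rewrite in_setI wA.
        rewrite CE => /set2P[wz|->]; last by rewrite !inE eqxx orbT.
        have : y \in outs D z :&: ins D z' by rewrite !inE -{1}wz wy yA.
        by rewrite S0 inE.
      have wa' : w \in A :\: B by rewrite in_setD wB.
      have aa' : a \in A :\: B by rewrite in_setD aB.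
      move: wa' aa'; rewrite a'E !in_set1 => /eqP-> /eqP->.
      by rewrite !inE eqxx !orbT.
    have [wB|wB] := boolP (w \in B).
      case: (no4 w y a e wy (yA a aA) (aR a e aA aB eR) (Rb w e wB wA eR)).
        exact: (neqS B).
      by rewrite eq_sym.
    have wR : w \in R.
      rewrite in_setC !in_setU1 in_setU !negb_or wx wA wB !andbT /=.
      by apply: contraTneq wy => ->; rewrite irrD.
    case: (no4 z a w y (za a aA aB) (aR a w aA aB wR) wy (yA z zA)).
      by have [_ _ wA' _] := RP w wR; apply: (neqS A).
    exact: (neqS A).
  have := subset_leq_card insy; have := (leq_card_setU [set x; z'] [set a]).1.
  rewrite cards1 cards2 => h1 h2; have dy := deg_ge y.
  by move: h1; case: (_ != _); nat_lia.
have /card_gt1P[z [z' [zC z'C zz]]] : 1 < #|A :&: B| by nat_lia.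
case: (two_paths_card no4 zz) => [/eqP S1|/eqP S2|[S1 S2]].
- by move: S1; rewrite (negbTE (disj z z' zC z'C zz)).
- by move: S2; rewrite (negbTE (disj z' z z'C zC _)) // eq_sym.
(* The degrees of [z] and [z'] sum to at least 2p - 2 and the intersections to at most 2, so both
   unions reach their maximum p - 2. *)
have [le1 le2] : #|T| <= #|outs D z :|: ins D z'| + 2 /\ #|T| <= #|outs D z' :|: ins D z| + 2.
  have := subset_leq_card (csub z z' zC z'C).
  have := subset_leq_card (csub z' z z'C zC).
  have := cardsC (A :&: B); have := deg_ge z; have := deg_ge z'.
  have := cardsUI (outs D z) (ins D z'); have := cardsUI (outs D z') (ins D z).
  by nat_lia.
have [za _] := full z z' zC z'C le1; have [_ bz] := full z' z z'C zC le2.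
by have := bz b bB bA; rewrite no_back // za.
Qed.

(** * Digraphs without 3-cycles *)

Definition no_3cycle (T : finType) (D : rel T) : Prop := forall x y z,
  D x y -> D y z -> D z x -> False.

Definition is_inl (A B : Type) (s : A + B) : bool := if s is inl _ then true else false.

Lemma complete_bipartiteE a b (s t : 'I_a + 'I_b) :
  complete_bipartite s t = (is_inl s != is_inl t).
Proof. by case: s t => [i|i] [j|j]. Qed.

(** The vertices of [X] are numbered first, and [split] cuts the index at [a]. *)
Lemma bipartition_bij (T : finType) (X : {set T}) (a b : nat) :
  #|X| = a -> #|~: X| = b ->
  exists2 f : T -> ('I_a + 'I_b)%type, bijective f & forall x, is_inl (f x) = (x \in X).
Proof.
move=> cX cXc; set s := enum X ++ enum (~: X).
have szX : size (enum X) = a by rewrite -cardE.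
have ltx x : index x s < a + b.
  have <- : size s = a + b by rewrite size_cat -!cardE cX cXc.
  by rewrite index_mem mem_cat !mem_enum in_setC orbN.
exists (fun x => split (Ordinal (ltx x))) => [|x]; last first.
  have -> : (x \in X) = (index x s < a).
    rewrite index_cat mem_enum; case: ifP => xX; last by rewrite szX ltnNge leq_addr.
    by rewrite -szX index_mem mem_enum.
  by case: splitP => [k|k] /= ->; rewrite ?ltn_ord // ltnNge leq_addr.
apply: inj_card_bij; last by rewrite card_sum !card_ord -cX -cXc cardsC.
move=> x y /(can_inj splitK)/(congr1 val)/= exy.
have mem v : v \in s by rewrite mem_cat !mem_enum in_setC orbN.
by rewrite -(nth_index x (mem x)) exy nth_index.
Qed.

Lemma bipartite_isomorphic (T : finType) (D : rel T) (X : {set T}) (a b : nat) :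
  #|X| = a -> #|~: X| = b -> (forall x y, D x y = ((x \in X) != (y \in X))) ->
  isomorphic D (@complete_bipartite a b).
Proof.
move=> cX cXc DX; have [f bf fX] := bipartition_bij cX cXc.
by exists f => // x y; rewrite complete_bipartiteE !fX DX.
Qed.

(** * Neighbourhoods of the ends of an arc, and odd order *)

Section No3Cycle.
Variables (T : finType) (D : rel T).
Hypotheses (irrD : irreflexive D) (no3 : no_3cycle D).

Lemma outs_ins_disjoint x y : D x y -> outs D y :&: ins D x = set0.
Proof.
by move=> xy; apply/setP => v; rewrite !inE; apply/negP => /andP[yv vx]; apply: no3 yv vx.
Qed.

Lemma card_outs_ins x y : D x y -> #|outs D y :|: ins D x| = #|outs D y| + #|ins D x|.
Proof. by move=> xy; rewrite cardsU (outs_ins_disjoint xy) cards0 subn0. Qed.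

Lemma one_way_sub x y : D x y -> ~~ D y x -> outs D y :|: ins D x \subset ~: [set x; y].
Proof.
move=> xy yx; apply/subsetP => v; rewrite !inE negb_or.
case/orP => [yv|vx]; apply/andP; split.
- by apply: contraNneq yx => <-.
- by apply: contraTneq yv => ->; rewrite irrD.
- by apply: contraTneq vx => ->; rewrite irrD.
- by apply: contraNneq yx => <-.
Qed.

Lemma one_way_bound x y : D x y -> ~~ D y x -> #|outs D y| + #|ins D x| + 2 <= #|T|.
Proof.
move=> xy yx; have := subset_leq_card (one_way_sub xy yx); rewrite card_outs_ins //.
by have := cardsC [set x; y]; rewrite cards2 (arc_neq irrD xy); nat_lia.
Qed.

Lemma odd_no_3cycle_sym n : #|T| = n.*2.+1 ->
  (forall x, n <= #|outs D x|) -> (forall x, n <= #|ins D x|) -> symmetric D.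
Proof.
move=> cT no ni; suff sub x y : D x y -> D y x by move=> x y; apply/idP/idP; apply: sub.
move=> xy; apply: contraT => yx; have := one_way_bound xy yx.
by have := no y; have := ni x; nat_lia.
Qed.

(** A vertex [x] of degree above n forces every neighbour of [x] to be joined to all of the
    complement of O(x), whose size is then n: this is the bipartite case. Otherwise the graph is
    n-regular, and a single vertex [z] lies outside the neighbourhoods of two adjacent vertices. *)
Lemma odd_no_3cycle n : #|T| = n.*2.+1 -> 2 <= n ->
  (forall x, n <= #|outs D x|) -> (forall x, n <= #|ins D x|) ->
  isomorphic D (@cycle_graph 5) \/ isomorphic D (@complete_bipartite n n.+1).
Proof.
move=> cT n2 no ni; have symD := odd_no_3cycle_sym cT no ni.
have insE x : ins D x = outs D x by apply/setP => v; rewrite !inE symD.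
have tri x y v : D x y -> D y v -> D x v = false.
  by move=> xy yv; rewrite symD; apply/negP => vx; apply: no3 xy yv vx.
have [/existsP[x nx]|/existsPn reg] := boolP [exists x, n < #|outs D x|].
  right.
  have full v : v \in outs D x -> outs D v = ~: outs D x /\ #|~: outs D x| = n.
    move=> xv; have cC := cardsC (outs D x); have nv := no v.
    have sub : outs D v \subset ~: outs D x.
      by apply/subsetP => w; move: xv; rewrite !inE => xv vw; rewrite (tri x v).
    have le := subset_leq_card sub.
    by split; [apply/eqP; rewrite eqEcard sub; nat_lia | nat_lia].
  have [v xv] : exists v, v \in outs D x by apply/card_gt0P; nat_lia.
  have [_ cX] := full v xv; have cC := cardsC (outs D x).
  apply: (bipartite_isomorphic cX); first by rewrite setCK; nat_lia.
  have key u w : u \in outs D x -> D u w = (w \notin outs D x).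
    by move=> /full[uE _]; rewrite -in_setC -uE inE.
  move=> u w; rewrite !in_setC.
  have [uX|uX] := boolP (u \in outs D x); first by rewrite key //; case: (w \in _).
  have [wX|wX] := boolP (w \in outs D x); first by rewrite symD key // uX.
  by apply: (tri u v w); [rewrite symD key | rewrite key].
left.
have dE x : #|outs D x| = n by have := no x; have := reg x; nat_lia.
have /card_gt0P[x _] : 0 < #|T| by rewrite cT.
have [y] : exists y, y \in outs D x by apply/card_gt0P; rewrite dE; nat_lia.
rewrite inE => xy.
have I0 := outs_ins_disjoint xy; rewrite insE in I0.
have U : #|outs D y :|: outs D x| = n + n by rewrite -[outs D x]insE card_outs_ins // insE !dE.
have /cards1P[z zE] : #|~: (outs D y :|: outs D x)| == 1.
  by apply/eqP; have := cardsC (outs D y :|: outs D x); nat_lia.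
have : z \in ~: (outs D y :|: outs D x) by rewrite zE set11.
rewrite !inE negb_or => /andP[yz xz].
have cover v : [\/ D y v, D x v | v = z].
  have [yv|yv] := boolP (D y v); first by apply: Or31.
  have [xv|xv] := boolP (D x v); first by apply: Or32.
  by apply: Or33; apply/eqP; rewrite -in_set1 -zE !inE negb_or yv.
set A := outs D z :&: outs D x; set B := outs D z :&: outs D y.
have cAB : #|A| + #|B| = n.
  have UAB : A :|: B = outs D z.
    rewrite -setIUr; apply/setIidPl/subsetP => v; rewrite !inE => zv.
    have [->|->|ev] := cover v; rewrite ?orbT //.
    by rewrite ev irrD in zv.
  have IAB : A :&: B = set0.
    apply/setP => v; rewrite !inE; apply/negP => /andP[/andP[_ xv] /andP[_ yv]].
    by rewrite (tri x y) in xv.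
  by have := cardsUI A B; rewrite UAB IAB cards0 dE addn0.
have subA : A \subset outs D x :\ y.
  apply/subsetP => v; rewrite !inE => /andP[zv ->]; rewrite andbT.
  by apply: contraTneq zv => ->; rewrite symD (negbTE yz).
have subB : B \subset outs D y :\ x.
  apply/subsetP => v; rewrite !inE => /andP[zv ->]; rewrite andbT.
  by apply: contraTneq zv => ->; rewrite symD (negbTE xz).
have lA : #|A| < n.
  by have := subset_leq_card subA; have := cardsD1 y (outs D x); rewrite inE xy dE; nat_lia.
have lB : #|B| < n.
  by have := subset_leq_card subB; have := cardsD1 x (outs D y); rewrite inE symD xy dE; nat_lia.
have [a aA] : exists a, a \in A by apply/card_gt0P; nat_lia.
have [b bB] : exists b, b \in B by apply/card_gt0P; nat_lia.
have := aA; rewrite !inE => /andP[za xa]; have := bB; rewrite !inE => /andP[zb yb].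
(* The n neighbours of [a] avoid O(x) and O(z), hence lie in {z} u (O(y) \ B), which has at most n +
   1 - |B| elements. *)
have B1 : #|B| <= 1.
  have sub : outs D a \subset z |: (outs D y :\: B).
    apply/subsetP => w; rewrite !inE => aw; rewrite (tri z a) //=.
    by have [->|xw|->] := cover w; rewrite ?eqxx ?orbT //; rewrite (tri x a) in xw.
  have := subset_leq_card sub; rewrite cardsU1 cardsD dE.
  have -> : outs D y :&: B = B by apply/setIidPr; apply: subsetIr.
  by rewrite dE; case: (_ \notin _); nat_lia.
have A1 : #|A| <= 1.
  have sub : outs D b \subset z |: (outs D x :\: A).
    apply/subsetP => w; rewrite !inE => bw; rewrite (tri z b) //=.
    by have [yw|->|->] := cover w; rewrite ?eqxx ?orbT //; rewrite (tri y b) in yw.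
  have := subset_leq_card sub; rewrite cardsU1 cardsD dE.
  have -> : outs D x :&: A = A by apply/setIidPr; apply: subsetIr.
  by rewrite dE; case: (_ \notin _); nat_lia.
have nE : n = 2 by nat_lia.
have T5 : #|T| = 5 by rewrite cT nE.
have [yx ax by_ az bz] : [/\ D y x, D a x, D b y, D a z & D b z].
  by rewrite !(symD _ x) !(symD _ z) (symD b).
have xb : D x b = false by rewrite (tri x y).
have ya : D y a = false by rewrite (tri y x).
have ab : D a b = false by rewrite (tri a z).
have ne u v w : D u v -> D u w = false -> v != w.
  by move=> uv uw; apply: contraTneq uv => ->; rewrite uw.
have sy u v : D u v = false -> D v u = false by rewrite symD.
have [xzF yzF] := (negbTE xz, negbTE yz).
(* Listed in cyclic order of the 5-cycle, so that indices match [cycle_graph]. *)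
have us : uniq [:: x; y; b; z; a].
  rewrite /= !inE !negb_or (arc_neq irrD xy) (arc_neq irrD xa) (arc_neq irrD yb).
  rewrite (arc_neq irrD za) (arc_neq irrD bz).
  by rewrite (ne _ _ _ ax ab) (ne _ _ _ yx yzF) (ne _ _ _ xy xzF)
    (ne _ _ _ by_ (sy _ _ ab)) (ne _ _ _ yb ya).
have bid : bijective (@id 'I_5) by exists id.
apply: (isomorphic_enum (x0 := x) us (erefl 5) T5 bid).
by case=> [[|[|[|[|[|//]]]]] ?] [[|[|[|[|[|//]]]]] ?] /=;
  rewrite ?irrD ?xy ?yx ?xa ?ax ?yb ?by_ ?zb ?bz ?za ?az ?xb ?ya ?ab ?xzF ?yzF
    ?(sy _ _ xb) ?(sy _ _ ya) ?(sy _ _ ab) ?(sy _ _ xzF) ?(sy _ _ yzF).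
Qed.

End No3Cycle.

(** * Even order without 3-cycles *)

Lemma no_3cycle_rev (T : finType) (D : rel T) : no_3cycle D -> no_3cycle (fun x y => D y x).
Proof. by move=> no3 x y z xy yz zx; apply: no3 xy zx yz. Qed.

Section Even.
Variables (T : finType) (D : rel T) (n : nat).
Hypotheses (irrD : irreflexive D) (no3 : no_3cycle D) (cT : #|T| = n.*2) (n3 : 3 <= n).
Hypothesis semi_out : forall x, n <= #|outs D x|.+1.
Hypothesis semi_in : forall x, n <= #|ins D x|.+1.
Hypothesis deg_ge : forall x, n.*2 <= #|outs D x| + #|ins D x| + 1.

(** Both |O(y)| and |I(x)| are at least n - 1, and [one_way_bound] caps their sum at 2n - 2; the
    degree bound 2n - 1 does the rest. *)
Lemma one_way_card x y : D x y -> ~~ D y x ->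
  [/\ #|outs D y|.+1 = n, #|ins D x|.+1 = n, n <= #|outs D x| & n <= #|ins D y|].
Proof.
move=> xy yx; have := one_way_bound irrD no3 xy yx.
have := semi_out y; have := semi_in x; have := deg_ge x; have := deg_ge y.
by move=> h1 h2 h3 h4 h5; split; nat_lia.
Qed.

Lemma one_way_cover x y v : D x y -> ~~ D y x -> v != x -> v != y -> D y v || D v x.
Proof.
move=> xy yx vx vy; have [o i _ _] := one_way_card xy yx.
have /eqP : outs D y :|: ins D x == ~: [set x; y].
  rewrite eqEcard (one_way_sub irrD xy yx) card_outs_ins //.
  by have := cardsC [set x; y]; rewrite cards2 (arc_neq irrD xy); nat_lia.
by move/setP/(_ v); rewrite !inE negb_or vx vy.
Qed.

(** Otherwise S = {y1, y2} u I(x) has n + 1 elements and lies in O(x). For [s] in I(x), disjointness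
    of O(x) and I(s) forces O(x) = S and makes I(s) the complement of S. Then O(s) avoids S too, so
    d(s) <= 2(n - 1). *)
Lemma one_way_out_unique x y1 y2 : D x y1 -> ~~ D y1 x -> D x y2 -> ~~ D y2 x -> y1 = y2.
Proof.
move=> xy1 yx1 xy2 yx2; apply/eqP/negPn/negP => yy.
have [_ ix ox _] := one_way_card xy1 yx1.
have sym w : D w x -> D x w.
  move=> wx; apply: contraT => xw; have [h _ _ _] := one_way_card wx xw.
  by nat_lia.
set S := y1 |: (y2 |: ins D x).
have cS : #|S| = n.+1.
  by rewrite !cardsU1 !inE (negbTE yy) (negbTE yx1) (negbTE yx2) /=; nat_lia.
have subS : S \subset outs D x.
  apply/subsetP => v; rewrite !inE => /or3P[/eqP->|/eqP->|/sym] //.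
have [s] : exists s, s \in ins D x by apply/card_gt0P; nat_lia.
rewrite inE => sx; have xs := sym s sx.
have := card_outs_ins no3 sx => h1.
have b1 := subset_leq_card (subsetT (outs D x :|: ins D s)); rewrite cardsT in b1.
have lS := subset_leq_card subS.
have is1 := semi_in s.
have sE : S = outs D x by apply/eqP; rewrite eqEcard subS; nat_lia.
have insE : ins D s = ~: S.
  apply/eqP; rewrite eqEcard; apply/andP; split; last by have := cardsC S; nat_lia.
  apply/subsetP => v; rewrite in_setC sE !inE => vs; apply/negP => xv.
  exact: no3 xv vs sx.
(* The complement of S has n - 1 >= 2 elements, one of them [x]. The vertex [w] yields the 3-cycles
   [s y1 w] and [s y2 w] that keep [y1] and [y2] out of O(s). *)
have [w] : exists w, w \in ~: S :\ x.
  apply/card_gt0P; have := cardsD1 x (~: S); have := cardsC S.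
  by rewrite in_setC sE inE irrD; nat_lia.
rewrite in_setD1 => /andP[wx wS]; have ws : D w s by rewrite -insE inE in wS.
have yw y : D x y -> ~~ D y x -> y \in S -> D y w.
  move=> xy yx yS; have wy : w != y by apply: contraTneq wS => ->; rewrite in_setC yS.
  have /orP[//|w_x] := one_way_cover xy yx wx wy.
  by move: wS; rewrite in_setC sE inE sym.
have outs0 : outs D s \subset ~: S.
  apply/subsetP => v; rewrite !inE => sv; rewrite !negb_or; apply/and3P; split.
  - apply/eqP => ev; rewrite ev in sv; apply: no3 sv (yw y1 xy1 yx1 _) ws.
    by rewrite !inE eqxx.
  - apply/eqP => ev; rewrite ev in sv; apply: no3 sv (yw y2 xy2 yx2 _) ws.
    by rewrite !inE eqxx orbT.
  - by apply/negP => vx; apply: no3 sv vx xs.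
have := subset_leq_card outs0; rewrite -insE => le.
have := deg_ge s; have := cardsC S; rewrite -insE; nat_lia.
Qed.

End Even.

(** A triangle of the underlying graph [G] contains at most one arc without reverse, since these
    form a matching, so one of its two orientations is a 3-cycle of [D]. Minimum degree n in [G]
    holds because od + id >= 2n - 1. *)
Lemma even_no_3cycle (T : finType) (D : rel T) n : irreflexive D -> no_3cycle D ->
  #|T| = n.*2 -> 3 <= n -> (forall x, n <= #|outs D x|.+1) -> (forall x, n <= #|ins D x|.+1) ->
  (forall x, n.*2 <= #|outs D x| + #|ins D x| + 1) -> in_B n D.
Proof.
move=> irrD no3 cT n3 semi_out semi_in deg_ge.
have outU := one_way_out_unique irrD no3 cT n3 semi_out semi_in deg_ge.
have deg_ge' x : n.*2 <= #|ins D x| + #|outs D x| + 1 by rewrite [#|ins _ _| + _]addnC.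
have inU x y1 y2 : D y1 x -> ~~ D x y1 -> D y2 x -> ~~ D x y2 -> y1 = y2.
  exact: (one_way_out_unique (D := fun u v => D v u) irrD (no_3cycle_rev no3) cT n3
    semi_in semi_out deg_ge').
have mixed x y v : D x y -> ~~ D y x -> D v x -> ~~ D x v -> False.
  move=> xy yx vx xv.
  have [_ i1 o1 _] := one_way_card irrD no3 cT n3 semi_out semi_in deg_ge xy yx.
  have [o2 _ _ _] := one_way_card irrD no3 cT n3 semi_out semi_in deg_ge vx xv.
  by nat_lia.
have matching u v w : D u v != D v u -> D u w != D w u -> v = w.
  case uv: (D u v); case vu: (D v u) => // _; case uw: (D u w); case wu: (D w u) => // _.
  - by apply: (outU u); rewrite ?vu ?wu.
  - by case: (mixed u v w); rewrite ?vu ?uw.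
  - by case: (mixed u w v); rewrite ?wu ?uv.
  - by apply: (inU u); rewrite ?uv ?uw.
pose G u v := D u v || D v u.
have symG u v : G u v = G v u by rewrite /G orbC.
have irrG : irreflexive G by move=> u; rewrite /G irrD.
have triG u v w : G u v -> G v w -> G u w = false.
  move=> uv vw; apply/negP => uw.
  have vwn : v != w by apply: contraTneq vw => ->; rewrite irrG.
  have uwn : u != w by apply: contraTneq uw => ->; rewrite irrG.
  have uvn : u != v by apply: contraTneq uv => ->; rewrite irrG.
  have m1 := matching u v w; have m2 := matching v u w; have m3 := matching w u v.
  move: uv vw uw m1 m2 m3 (@no3 u v w) (@no3 u w v); rewrite /G.
  case: (D u v); case: (D v u); case: (D v w); case: (D w v);
  case: (D u w); case: (D w u) => //= _ _ _ m1 m2 m3 c1 c2.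
  all: try by case: c1.
  all: try by case: c2.
  all: try by move: vwn; rewrite m1 ?eqxx.
  all: try by move: uwn; rewrite m2 ?eqxx.
  all: try by move: uvn; rewrite m3 ?eqxx.
have degG x : n <= #|outs G x|.
  have := subset_leq_card (_ : outs D x \subset outs G x).
  have := subset_leq_card (_ : ins D x \subset outs G x).
  have := deg_ge x; move=> d h1 h2.
  have {}h1 : #|ins D x| <= #|outs G x|.
    by apply: h1; apply/subsetP => v; rewrite !inE /G => ->; rewrite orbT.
  have {}h2 : #|outs D x| <= #|outs G x|.
    by apply: h2; apply/subsetP => v; rewrite !inE /G => ->.
  by nat_lia.
have /card_gt0P[x _] : 0 < #|T| by nat_lia.
set X := outs G x.
have nbr v : v \in X -> outs G v = ~: X /\ #|X| = n.
  rewrite inE => xv; have sub : outs G v \subset ~: X.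
    by apply/subsetP => w; rewrite !inE => vw; rewrite (triG x v).
  have := subset_leq_card sub; have := cardsC X; have := degG v; have := degG x; rewrite -/X.
  by move=> h1 h2 h3 h4; split; [apply/eqP; rewrite eqEcard sub; nat_lia | nat_lia].
have [v vX] : exists v, v \in X by apply/card_gt0P; have := degG x; rewrite -/X; nat_lia.
have [_ cX] := nbr v vX; have cXc : #|~: X| = n by have := cardsC X; nat_lia.
have GX u w : G u w = ((u \in X) != (w \in X)).
  have key s t : s \in X -> G s t = (t \notin X).
    by move=> /nbr[E _]; rewrite -in_setC -E inE.
  have [uX|uX] := boolP (u \in X); first by rewrite key //; case: (w \in X).
  have [wX|wX] := boolP (w \in X); first by rewrite symG key // uX.
  by apply: (triG u v w); [rewrite symG key | rewrite key].
have [f bf fX] := bipartition_bij cX cXc; have injf := bij_inj bf.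
split; first by nat_lia.
(* The deleted arcs are the missing reverses of the one-way arcs. Each has exactly one end in [X],
   which bounds their number by n. *)
pose E := [set e : T * T | D e.2 e.1 && ~~ D e.1 e.2].
exists [set (f e.1, f e.2) | e in E].
have EP e : e \in E -> G e.1 e.2 /\ D e.1 e.2 != D e.2 e.1.
  by rewrite inE /G => /andP[-> /negbTE->].
split.
- move=> _ /imsetP[e /EP[Ge _] ->]; by rewrite complete_bipartiteE !fX -GX.
- apply: leq_trans (leq_imset_card _ _) _.
  pose g (e : T * T) := if e.1 \in X then e.1 else e.2.
  have gX e : e \in E -> g e \in X.
    by move=> /EP[]; rewrite GX /g; case: ifP => // _; case: (e.2 \in X).
  rewrite -(card_in_imset (f := g)).
    by rewrite -cX; apply: subset_leq_card; apply/subsetP => _ /imsetP[e eE ->]; apply: gX.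
  (* The end of an unmatched pair lying in [X] determines the pair. *)
  move=> [u1 w1] [u2 w2] e1 e2; rewrite /g /=.
  have := EP _ e1; have := EP _ e2; rewrite /= => -[_ d2] [_ d1].
  rewrite inE /= in e1; rewrite inE /= in e2; move: e1 e2 d1 d2.
  have [u1X|u1X] := boolP (u1 \in X); have [u2X|u2X] := boolP (u2 \in X) => /=.
  - by move=> _ _ d1 d2 eu; rewrite -eu in d2 *; rewrite (matching _ _ _ d1 d2).
  - move=> /andP[p1 q1] /andP[p2 q2] d1 d2 eu; rewrite -eu eq_sym in d2.
    by rewrite -eu (matching _ _ _ d1 d2) in p2 q1 p1 q2; rewrite p2 in q1.
  - move=> /andP[p1 q1] /andP[p2 q2] d1 d2 eu; rewrite eu eq_sym in d1.
    by rewrite eu (matching _ _ _ d1 d2) in p1 q1; rewrite p1 in q2.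
  - move=> _ _ d1 d2 eu; rewrite eq_sym in d1; rewrite -eu eq_sym in d2 *.
    by rewrite (matching _ _ _ d1 d2).
- move=> _ _ /imsetP[[u1 w1] e1 ->] /imsetP[[u2 w2] e2 ->] /= ne.
  have [_ /= d1] := EP _ e1; have [_ /= d2] := EP _ e2.
  move: e1 e2; rewrite !inE /= => /andP[p1 q1] /andP[p2 q2].
  have d1' := d1; have d2' := d2; rewrite eq_sym in d1'; rewrite eq_sym in d2'.
  rewrite disjoint_has /= orbF negb_or !inE !(inj_eq injf) !negb_or.
  apply/andP; split; apply/andP; split; apply: contraNneq ne => ee; subst.
  - by rewrite (matching _ _ _ d1 d2).
  - by move: q1; rewrite (matching _ _ _ d1 d2') p2.
  - by move: q2; rewrite -(matching _ _ _ d1' d2) p1.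
  - by rewrite (matching _ _ _ d1' d2').
exists f => // u w; rewrite complete_bipartiteE !fX -GX.
have -> : ((f u, f w) \in [set (f e.1, f e.2) | e in E]) = D w u && ~~ D u w.
  apply/imsetP/idP => [[[u' w'] + [/injf-> /injf->]]|h]; first by rewrite inE.
  by exists (u, w); rewrite ?inE.
by rewrite /G; case: (D u w); case: (D w u).
Qed.

(** * Decidability of cycles, numerical form of the hypotheses, and case split on the order *)

Lemma has_cycle_dec (T : finType) (D : rel T) k : has_cycle D k \/ ~ has_cycle D k.
Proof.
have [/existsP[c /andP[cc uc]]|/existsPn no] := boolP [exists c : k.-tuple T, cycle D c && uniq c].
  by left; exists c; rewrite size_tuple.
right=> -[c [szc cc uc]]; have := no (Tuple (introT eqP szc)).
by rewrite /= cc uc.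
Qed.

Lemma has_3cycle (T : finType) (D : rel T) x y z : irreflexive D ->
  D x y -> D y z -> D z x -> has_cycle D 3.
Proof.
move=> irrD xy yz zx; exists [:: x; y; z]; split=> //=; first by rewrite xy yz zx.
by rewrite !inE negb_or (arc_neq irrD xy) (arc_neq irrD yz) eq_sym (arc_neq irrD zx).
Qed.

(** The quotient p/2 is rational and not rounded: p = 2n + 1 yields semidegrees at least n, and p =
    2n yields n - 1. *)
Lemma semidegree_nat (p m : nat) :
  (p%:R / 2%:R - 1 <= m%:R :> rat)%R -> p <= 2 * m + 2.
Proof.
rewrite Num.Theory.lerBlDr Num.Theory.ler_pdivrMr // GRing.natr1 -GRing.natrM Num.Theory.ler_nat.
nat_lia.
Qed.

Theorem theorem4p3 (T : finType) (D : rel T) (p n : nat)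
  (loopless : irreflexive D)
  (order_D : #|T| = p)
  (p_ge5 : 5 <= p)
  (deg_ge : forall x : T, p - 1 <= deg D x)
  (semideg_ge : forall x : T,
     (p%:R / 2%:R - 1 <= (minn (indeg D x) (outdeg D x))%:R :> rat)%R)
  (def_n : n = p./2) :
  (has_cycle D 3 \/
   in_B n D \/
   isomorphic D (@cycle_graph 5) \/
   isomorphic D (@complete_bipartite n n.+1))
  /\
  (has_cycle D 4 \/
   in_H 3 D \/
   isomorphic D (@cycle_graph 5) \/
   isomorphic D H6' \/
   isomorphic D H6'' \/
   isomorphic D H6''' \/
   isomorphic D
     (join (disjoint_union (@complete 2) (@complete 2)) (@complete 1))).
Proof.
have semi x : p <= 2 * minn (indeg D x) (outdeg D x) + 2 by apply: semidegree_nat.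
have so x : p <= 2 * #|outs D x| + 2.
  by have := semi x; have := geq_minr (indeg D x) (outdeg D x); rewrite /outdeg -/(outs D x); nat_lia.
have si x : p <= 2 * #|ins D x| + 2.
  by have := semi x; have := geq_minl (indeg D x) (outdeg D x); rewrite /indeg -/(ins D x); nat_lia.
have dg x : p <= #|outs D x| + #|ins D x| + 1.
  have := deg_ge x; rewrite /deg /outdeg /indeg -/(outs D x) -/(ins D x); nat_lia.
have pE := odd_double_half p; rewrite -def_n in pE.
split.
- have [|no] := has_cycle_dec D 3; [by left | right].
  have no3 : no_3cycle D by move=> x y z xy yz zx; apply: no (has_3cycle loopless xy yz zx).
  case podd: (odd p) pE => /= pE.
    right; apply: (odd_no_3cycle loopless no3).
    + by rewrite order_D; nat_lia.
    + by nat_lia.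
    + by move=> x; have := so x; nat_lia.
    + by move=> x; have := si x; nat_lia.
  left; apply: (even_no_3cycle loopless no3).
  + by rewrite order_D; nat_lia.
  + by nat_lia.
  + by move=> x; have := so x; nat_lia.
  + by move=> x; have := si x; nat_lia.
  + by move=> x; have := dg x; nat_lia.
- have [|no] := has_cycle_dec D 4; [by left | right].
  have no4 : no_4cycle D.
    by move=> x y z w xy yz zw wx xz yw; apply: no (has_4cycle loopless xy yz zw wx xz yw).
  rewrite -order_D in so si dg p_ge5.
  have [p7|p7] := leqP 7 #|T|.
    have sym := no_4cycle_sym loopless no4 so si dg p7.
    exfalso; apply: (no_4cycle_asym loopless no4 _ p7) => [x|x y]; last by apply/idP/idP; apply: sym.
    have insE : ins D x = outs D x.
      by apply/setP => v; rewrite !inE; apply/idP/idP; apply: sym.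
    by have := dg x; rewrite insE; nat_lia.
  have so2 x : 2 <= outdeg D x by have := so x; rewrite /outdeg -/(outs D x); nat_lia.
  have si2 x : 2 <= indeg D x by have := si x; rewrite /indeg -/(ins D x); nat_lia.
  have [p5|p6] : #|T| = 5 \/ #|T| = 6 by nat_lia.
    by case: (order5_no4cycle loopless p5 no si2 so2); tauto.
  have d5 x : 5 <= deg D x by have := deg_ge x; rewrite -order_D p6.
  by case: (order6_no4cycle loopless p6 no si2 so2 d5); tauto.
Qed.
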